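(* Let $(N,v)$ be a balanced game and let $\mathcal{C} \subseteq \mathcal{N}$ be a feasible collection of coalitions, i.e. $X_{\mathcal{C}}(v) \neq \emptyset$. Then $X_{\mathcal{C}}(v)$ is not a blind spot if and only if there exists a coalition $S \in \mathcal{C}$ such that the collection $\mathcal{C} \cup \{ \{i\} \mid i \in S \}$ is unbalanced on $N$.
   Context: A game is a pair $(N,v)$ with $N$ a nonempty finite set of players and $v : 2^N \to \mathbb{R}$ with $v(\emptyset)=0$. Let $\mathcal{N}$ be the set of nonempty subsets of $N$ (coalitions). For $x \in \mathbb{R}^N$ and $S \subseteq N$, $x(S) = \sum_{i\in S} x_i$. The set of preimputations is $X(v) = \{x \in \mathbb{R}^N \mid x(N) = v(N)\}$. A collection $\mathcal{B} \subseteq \mathcal{N}$ is balanced on $N$ if there are positive weights $(\lambda_S)_{S\in\mathcal{B}}$ with $\sum_{S \in \mathcal{B}} \lambda_S \mathbf{1}^S = \mathbf{1}^N$, where $\mathbf{1}^S \in \mathbb{R}^N$ is the indicator vector of $S$. A collection is unbalanced on $N$ if it does not contain (as a subcollection, possibly itself) any balanced collection on $N$. The game $(N,v)$ is balanced if for every balanced collection $\mathcal{B}$ on $N$ and every system of positive weights $(\lambda_S)_{S \in \mathcal{B}}$ satisfying $\sum_{S \in \mathcal{B}} \lambda_S \mathbf{1}^S = \mathbf{1}^N$, one has $\sum_{S\in\mathcal{B}} \lambda_S v(S) \le v(N)$. For a collection $\mathcal{C} \subseteq \mathcal{N}$, the associated region is $X_{\mathcal{C}}(v) = \{x \in X(v)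 \mid \text{for every } S \in \mathcal{N},\ x(S) < v(S) \text{ if and only if } S \in \mathcal{C}\}$; $\mathcal{C}$ is feasible if $X_{\mathcal{C}}(v) \neq \emptyset$. For $x \in X(v)$, let $\phi(x) = \{S \in \mathcal{N} \mid x(S) < v(S)\}$. For $S \in \mathcal{N}$, let $\delta_S(x) = \{y \in X(v) \mid y_i > x_i \text{ for all } i \in S\}$ (domination cone). Let $\mathrm{Aug}(x) = \{y \in X(v) \mid y(S) \ge x(S) \text{ for all } S \in \phi(x)\}$ (augmentation cone), and let $$\zeta(x) = \mathrm{Aug}(x) \cap \Big( \bigcup_{S \in \phi(x)} \delta_S(x) \Big).$$ For a feasible collection $\mathcal{C}$, the region $X_{\mathcal{C}}(v)$ is a blind spot if $\zeta(x) = \emptyset$ for all $x \in X_{\mathcal{C}}(v)$. *)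

(* Defs.v *)
From HB Require Import structures.
From mathcomp Require Import all_boot all_order all_algebra.
From mathcomp Require Import boolp classical_sets reals.
Set Implicit Arguments.
Unset Strict Implicit.
Unset Printing Implicit Defensive.
Import Order.TTheory GRing.Theory Num.Theory.
Local Open Scope classical_set_scope.
Local Open Scope ring_scope.

(* Coalitions and collections are finite sets, [{set N}] and [{set {set N}}]; *)
(* subsets of the payoff space [{ffun N -> R}] are classical sets [set _].    *)

Definition coalitions (N : finType) : {set {set N}} :=
  [set S : {set N} | S != finset.set0]%SET.

Section Games.
Variables (R : realType) (N : finType).
Implicit Types (v : {set N} -> R) (x y : {ffun N -> R}) (S : {set N})
  (B C : {set {set N}}) (w : {set N} -> R).

Definition indic S (i : N) : R := (i \in S)%:R.

(* The values of [w] outside [B] are irrelevant. *)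
Definition balancing_weights B w : Prop :=
  (forall S, S \in B -> 0 < w S) /\
  (forall i : N, \sum_(S in B) w S * indic S i = indic [set: N]%SET i).

Definition balanced_collection B : Prop :=
  B \subset coalitions N /\ exists w, balancing_weights B w.

Definition unbalanced_collection C : Prop :=
  forall B, B \subset C -> ~ balanced_collection B.

Definition balanced_game v : Prop :=
  forall B, balanced_collection B ->
  forall w, balancing_weights B w ->
    \sum_(S in B) w S * v S <= v [set: N]%SET.

Definition payoff x S : R := \sum_(i in S) x i.

Definition preimputations v : set {ffun N -> R} :=
  [set x | payoff x [set: N]%SET = v [set: N]%SET].

Definition region v C : set {ffun N -> R} :=
  [set x | preimputations v x /\
    forall S, S \in coalitions N -> (payoff x S < v S <-> S \in C)].

Definition feasible v C : Prop := C \subset coalitions N /\ (region v C !=set0)%classic.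

Definition phi v x : {set {set N}} :=
  [set S in coalitions N | payoff x S < v S]%SET.

Definition domination_cone v S x : set {ffun N -> R} :=
  [set y | preimputations v y /\ forall i, i \in S -> x i < y i].

Definition augmentation_cone v x : set {ffun N -> R} :=
  [set y | preimputations v y /\
    forall S, S \in phi v x -> payoff x S <= payoff y S].

Definition zeta v x : set {ffun N -> R} :=
  augmentation_cone v x `&`
  \bigcup_(S in [set` phi v x]) domination_cone v S x.

Definition blind_spot v C : Prop :=
  forall x, region v C x -> zeta v x = set0.

End Games.

Arguments balanced_collection R {N} B.
Arguments unbalanced_collection R {N} C.

(* Main.v *)
Require Import Defs.
From HB Require Import structures.
From mathcomp Require Import all_boot all_order all_algebra.
From mathcomp Require Import boolp classical_sets reals.
Set Implicit Arguments.
Unset Strict Implicit.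
Unset Printing Implicit Defensive.
Import Order.TTheory GRing.Theory Num.Theory.
Local Open Scope ring_scope.

(* After adding z := y - x, non-blindness of the region says that some z with  *)
(* z(N) = 0 satisfies z(T) >= 0 on C and z > 0 on the players of some S in C.  *)
(* Such a z pairs nonnegatively with any balanced B inside C and the           *)
(* singletons of S, with total z(N) = 0; hence B avoids these singletons and   *)
(* lies in C, which a balanced game forbids.  Conversely, if the collection is *)
(* unbalanced then 1^N is outside the cone generated by its indicators, and    *)
(* Farkas' lemma gives u with u >= 0 on the collection and u(N) < 0; the       *)
(* translate of u by a positive constant with total 0 is the required z.       *)

(** Balancedness of the game enters only in the forward direction: if all members of a balanced [B]
    lie in [C], weighting the strict inequalities x(T) < v(T) gives v(N) = x(N) < sum of w(T) v(T),
    against [v_balanced]. The totals come from [payoff_balanced]. The backward direction rests on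
    [farkas] through [unbalanced_separation]; its z does not depend on x, so it serves at any point
    of the region. *)

Definition dot (R : realFieldType) (K : finType) (u x : K -> R) : R :=
  \sum_k u k * x k.

Lemma dotC (R : realFieldType) (K : finType) (u x : K -> R) :
  dot u x = dot x u.
Proof. by apply: eq_bigr => k _; rewrite mulrC. Qed.

Lemma dotBZr (R : realFieldType) (K : finType) (u x y : K -> R) (c : R) :
  dot u (fun k => x k - c * y k) = dot u x - c * dot u y.
Proof.
rewrite /dot mulr_sumr -sumrB; apply: eq_bigr => k _.
by rewrite mulrBr mulrCA.
Qed.

Lemma dotBZl (R : realFieldType) (K : finType) (u w x : K -> R) (c : R) :
  dot (fun k => u k - c * w k) x = dot u x - c * dot w x.
Proof. by rewrite dotC dotBZr !(dotC x). Qed.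

Lemma dot_sumr (R : realFieldType) (K : finType) (I : Type) (s : seq I)
    (P : pred I) (u : K -> R) (c : I -> R) (a : I -> K -> R) :
  dot u (fun k => \sum_(i <- s | P i) c i * a i k) =
  \sum_(i <- s | P i) c i * dot u (a i).
Proof.
rewrite /dot; under eq_bigr do rewrite mulr_sumr.
rewrite exchange_big; apply: eq_bigr => i _.
by rewrite mulr_sumr; apply: eq_bigr => k _; rewrite mulrCA.
Qed.

(** Induction on the number of generators, valid over any ordered field. If the functional
    separating [b] from the cone of the tail is negative on the new generator, projecting along that
    generator reduces to the tail again. *)
Lemma farkas (R : realFieldType) (K : finType) (I : eqType) (s : seq I)
    (a : I -> K -> R) (b : K -> R) : uniq s ->
  (exists2 c : I -> R,
     forall i, 0 <= c i & forall k, b k = \sum_(i <- s) c i * a i k) \/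
  (exists2 u : K -> R, {in s, forall i, 0 <= dot u (a i)} & dot u b < 0).
Proof.
elim: s a b => [|i0 s IHs] a b /= s_uniq.
  have [b0|/existsP[k bk]] := boolP [forall k, b k == 0].
    by left; exists (fun=> 0) => // k; rewrite big_nil; apply/eqP/(forallP b0).
  right; exists (fun k => - b k) => //.
  rewrite /dot; under eq_bigr do rewrite mulNr -expr2.
  rewrite sumrN oppr_lt0 (bigD1 k) //= ltr_pwDl ?exprn_even_gt0 //.
  by rewrite sumr_ge0 // => j _; rewrite sqr_ge0.
have {s_uniq} [i0s s_uniq] := andP s_uniq.
(* Since [i0] does not occur in [s], overwriting the coefficient at [i0] leaves the sum over the
   tail unchanged. *)
pose cons_coef c0 (c : I -> R) i := if i == i0 then c0 else c i.
have cons_coef_ge0 c0 c : 0 <= c0 -> (forall i, 0 <= c i) ->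
    forall i, 0 <= cons_coef c0 c i.
  by move=> c0_ge0 c_ge0 i; rewrite /cons_coef; case: eqP.
have sum_cons_coef c0 c x k :
    \sum_(i <- i0 :: s) cons_coef c0 c i * x i k =
    c0 * x i0 k + \sum_(i <- s) c i * x i k.
  rewrite big_cons /cons_coef eqxx; congr (_ + _); rewrite !big_seq.
  apply: eq_bigr => i i_s; case: eqP => // ii0.
  by rewrite ii0 (negPf i0s) in i_s.
case: (IHs a b s_uniq) => [[c c_ge0 bE]|[u u_ge0 ub_lt0]].
  left; exists (cons_coef 0 c) => [|k]; first exact: cons_coef_ge0.
  by rewrite sum_cons_coef mul0r add0r.
have [ua_ge0|ua_lt0] := leP 0 (dot u (a i0)).
  by right; exists u => // i; rewrite inE => /predU1P[->|/u_ge0].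
have ua_neq0 : dot u (a i0) != 0 by rewrite lt_eqF.
(* Project along [a i0] onto the hyperplane orthogonal to [u]. *)
pose proj (x : K -> R) k := x k - dot u x / dot u (a i0) * a i0 k.
have proj_dot w x :
    dot w (proj x) = dot (fun k => w k - dot w (a i0) / dot u (a i0) * u k) x.
  by rewrite dotBZr dotBZl mulrAC [in RHS]mulrAC (mulrC (dot u x)).
case: (IHs (proj \o a) (proj b) s_uniq) => [[c c_ge0 bE]|[w w_ge0 wb_lt0]].
  (* Undoing the projection of [b] and of each [a i] collects this coefficient on [a i0]. It is
     nonnegative: a quotient of two negatives minus a sum of nonpositive terms. *)
  left; exists (cons_coef (dot u b / dot u (a i0) -
    \sum_(i <- s) c i * (dot u (a i) / dot u (a i0))) c).
    apply: cons_coef_ge0 => //; rewrite subr_ge0 (@le_trans _ _ 0) //.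
      rewrite big_seq sumr_le0 // => i i_s.
      apply: mulr_ge0_le0 (c_ge0 i) (mulr_ge0_le0 (u_ge0 i i_s) _).
      by rewrite invr_le0 ltW.
    by apply: mulr_le0; rewrite ?invr_le0 ltW.
  move=> k; rewrite sum_cons_coef; have := bE k; rewrite /proj /=.
  move/(canRL (subrK _)) => ->; under eq_bigr do rewrite mulrBr mulrA.
  by rewrite sumrB -mulr_suml mulrBl [LHS]addrC addrA addrAC.
(* The adjoint of the projection applied to [w]; it vanishes on [a i0]. *)
right; exists (fun k => w k - dot w (a i0) / dot u (a i0) * u k).
  move=> i; rewrite inE => /predU1P[->|/w_ge0]; last by rewrite /= proj_dot.
  by rewrite dotBZl divfK ?subrr.
by rewrite -proj_dot.
Qed.

Section Unbalanced.
Variables (R : realType) (N : finType).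
Implicit Types (x : {ffun N -> R}) (S : {set N}) (C : {set {set N}}).

Lemma sum_indic (u : N -> R) S : \sum_(i in S) u i = dot u (indic R S).
Proof.
rewrite /dot [LHS]big_mkcond; apply: eq_bigr => i _.
by rewrite /indic; case: (i \in S); rewrite ?mulr1 ?mulr0.
Qed.

Lemma payoff_balanced B (w : {set N} -> R) x : balancing_weights B w ->
  \sum_(S in B) w S * payoff x S = payoff x [set: N]%SET.
Proof.
case=> _ wE; rewrite /payoff sum_indic; under eq_bigr do rewrite sum_indic.
by rewrite -dot_sumr; apply: eq_bigr => i _; rewrite wE.
Qed.

Lemma payoffB x y S : payoff (x - y) S = payoff x S - payoff y S.
Proof. by rewrite /payoff -sumrB; apply: eq_bigr => i _; rewrite !ffunE. Qed.

Lemma unbalanced_separation C : (0 < #|N|)%N -> C \subset coalitions N ->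
  unbalanced_collection R C ->
  exists2 z : {ffun N -> R}, payoff z [set: N]%SET = 0 &
    {in C, forall S, 0 < payoff z S}.
Proof.
move=> N_gt0 C_coal C_unbal.
case: (farkas (@indic R N) (indic R [set: N]%SET) (enum_uniq C)).
  case=> c c_ge0 cE; exfalso.
  (* Balancing weights must be positive, so the conic combination is restricted to its support. *)
  apply: (C_unbal [set S in C | 0 < c S]%SET).
    by apply/fintype.subsetP => S; rewrite inE => /andP[].
  split.
    apply: fintype.subset_trans C_coal.
    by apply/fintype.subsetP => S; rewrite inE => /andP[].
  exists c; split=> [S|i]; first by rewrite inE => /andP[].
  rewrite cE big_enum /= [RHS](bigID (fun S => 0 < c S)) /=.
  rewrite [X in _ = _ + X]big1 ?addr0 => [|S /andP[_]].
    by apply: eq_bigl => S; rewrite inE.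
  by rewrite lt_neqAle c_ge0 andbT negbK => /eqP<-; rewrite mul0r.
case=> u u_ge0 uN_lt0.
have sumu : dot u (indic R [set: N]%SET) = \sum_i u i.
  by apply: eq_bigr => i _; rewrite /indic inE mulr1.
(* Minus the mean of [u]: shifting by [t] brings the total to 0 and, coalitions being nonempty,
   makes the inequalities strict. *)
pose t := - (\sum_i u i) / #|N|%:R.
have t_gt0 : 0 < t by rewrite divr_gt0 ?ltr0n // oppr_gt0 -sumu.
have payoffE S : payoff [ffun i => u i + t] S = dot u (indic R S) + t *+ #|S|.
  rewrite /payoff; under eq_bigr do rewrite ffunE.
  by rewrite big_split /= sumr_const sum_indic.
exists [ffun i => u i + t].
  rewrite payoffE sumu cardsT -[_ *+ _]mulr_natr /t mulNr mulNr divfK ?subrr //.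
  by rewrite pnatr_eq0 -lt0n.
move=> S SC; rewrite payoffE ltr_wpDl ?u_ge0 ?mem_enum //.
rewrite pmulrn_lgt0 // card_gt0.
by have := fintype.subsetP C_coal S SC; rewrite inE.
Qed.

End Unbalanced.

Theorem theorem7 (R : realType) (N : finType) (v : {set N} -> R)
    (C : {set {set N}})
    (N_nonempty : (0 < #|N|)%N)
    (v_set0 : v finset.set0 = 0)
    (v_balanced : balanced_game v)
    (C_feasible : feasible v C) :
  ~ blind_spot v C <->
  (exists S : {set N}, S \in C /\
     unbalanced_collection R (C :|: [set [set i]%SET | i in S]%SET)%SET).
Proof.
have [C_coal [x0 x0_reg]] := C_feasible.
have phiE x : region v C x -> phi v x = C.
  case=> _ xC; apply/setP => S; rewrite inE; apply/andP/idP => [[S_coal ltS]|SC].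
    exact/(xC S S_coal).
  by have S_coal := fintype.subsetP C_coal S SC; split=> //; apply/(xC S S_coal).
split=> [not_blind|[S [SC unbal]]].
  have [x [x_reg [y [[yX yaug] [S Sphi [_ ydom]]]]]] :
      exists x, region v C x /\ (zeta v x !=set0)%classic.
    apply: contrapT => no_x; apply: not_blind => x x_reg.
    by apply: contrapT => /eqP/set0P zx; apply: no_x; exists x.
  rewrite /= phiE // in Sphi; rewrite phiE // in yaug.
  exists S; split=> // B BD [B_coal [w w_bal]].
  have [w_gt0 wE] := w_bal.
  have z_ge0 T : T \in B -> 0 <= w T * payoff (y - x) T.
    move=> TB; rewrite mulr_ge0 ?(ltW (w_gt0 _ TB)) // payoffB subr_ge0.
    have := fintype.subsetP BD T TB; rewrite inE => /orP[/yaug//|].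
    case/imsetP => i iS ->; rewrite /payoff !big_set1; exact/ltW/ydom.
  have z_eq0 : \sum_(T in B) w T * payoff (y - x) T = 0.
    by rewrite payoff_balanced // payoffB yX (proj1 x_reg) subrr.
  (* Nonnegative terms with zero sum all vanish, whereas the term of a singleton of a player of [S]
     is positive. *)
  have BC : B \subset C.
    apply/fintype.subsetP => T TB; have := fintype.subsetP BD T TB.
    rewrite inE => /orP[//|/imsetP[i iS Ti]].
    have /eqP := psumr_eq0P z_ge0 z_eq0 TB.
    rewrite mulf_eq0 (gt_eqF (w_gt0 _ TB)) /= payoffB subr_eq0 Ti.
    by rewrite /payoff !big_set1 (gt_eqF (ydom i iS)).
  (* The final inequality is strict only if [B] has a member; an empty sum cannot give 1 at a
     player. *)
  have [T0 T0B] : exists T, T \in B.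
    case/card_gt0P: N_nonempty => i _.
    have [B0|//] := set_0Vmem B.
      have := wE i; rewrite B0 big_set0 /indic inE => /esym/eqP.
      by rewrite oner_eq0.
    by case=> T TB; exists T.
  have := v_balanced B (conj B_coal (ex_intro _ w w_bal)) w w_bal.
  rewrite -(proj1 x_reg) -(payoff_balanced x w_bal) leNgt => /negP; apply.
  have lt_T T : T \in B -> w T * payoff x T < w T * v T.
    move=> TB; rewrite ltr_pM2l ?w_gt0 //.
    apply/(proj2 x_reg T (fintype.subsetP B_coal T TB)).
    exact: (fintype.subsetP BC).
  rewrite (bigD1 T0) //= [ltRHS](bigD1 T0) //= ltr_leD ?lt_T //.
  by apply: ler_sum => T /andP[TB _]; exact/ltW/lt_T.
have D_coal : C :|: [set [set i]%SET | i in S]%SET \subset coalitions N.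
  rewrite finset.subUset C_coal; apply/fintype.subsetP => _ /imsetP[i _ ->].
  by rewrite inE -card_gt0 cards1.
have [z zN z_gt0] := unbalanced_separation N_nonempty D_coal unbal.
have zC T : T \in C -> 0 < payoff z T by move=> TC; rewrite z_gt0 // inE TC.
have payoffxz T : payoff (x0 + z) T = payoff x0 T + payoff z T.
  by rewrite /payoff -big_split; apply: eq_bigr => i _; rewrite ffunE.
have xzX : preimputations v (x0 + z).
  by rewrite /preimputations /= payoffxz zN addr0; exact: (proj1 x0_reg).
move=> /(_ x0 x0_reg) /eqP; apply/negP/set0P; exists (x0 + z).
split.
  by split=> // T; rewrite phiE // payoffxz lerDl => /zC/ltW.
exists S; first by rewrite /= phiE.
split=> // i iS; rewrite ffunE ltrDl.
have /z_gt0 : [set i]%SET \in (C :|: [set [set i]%SET | i in S]%SET)%SET.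
  by rewrite inE imset_f ?orbT.
by rewrite /payoff big_set1.
Qed.
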